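(* For all integers $n\geq 0$ and $j\in\mathbb{Z}$, $$(n+2+3j)\,(w_n,t^{-j})=(n+2-3j)\,(w_n,t^{j}),$$ where $(w_n,t^j)$ denotes the coefficient of $t^j$ in $w_n(t)$.
   Context: For $n\geq 0$ let $P_n$ be a strictly convex polygon with $n+2$ vertices and a marked boundary edge $e_*$. A triangulation of $P_n$ is a decomposition into $n$ non-overlapping triangles with vertices among those of $P_n$. For $n\geq1$, its checkerboard colouring colours each triangle black or white such that the unique triangle containing $e_*$ is black and triangles sharing an edge have different colours; $n_b(\tau),n_w(\tau)$ denote the numbers of black and white triangles of $\tau$. Define the Laurent polynomial $w_n(t)=\sum_{\tau}t^{n_b(\tau)-n_w(\tau)}\in\mathbb{N}[t,t^{-1}]$, the sum over all triangulations $\tau$ of $P_n$, with $w_0(t)=1$. *)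

(* Defs.v *)
From HB Require Import structures.
From mathcomp Require Import all_boot all_order all_algebra.
From mathcomp Require Import boolp reals.
From mathcomp.multinomials Require Export monalg.

Set Implicit Arguments.
Unset Strict Implicit.
Unset Printing Implicit Defensive.

Import Order.TTheory GRing.Theory Num.Theory.
Local Open Scope ring_scope.

(* Twice the signed area of the triangle a, b, c: it is positive exactly when
   a, b, c are not collinear and are listed counterclockwise. *)
Definition orientation (R : realType) (a b c : 'rV[R]_2) : R :=
  (b 0 0 - a 0 0) * (c 0 1 - a 0 1) - (b 0 1 - a 0 1) * (c 0 0 - a 0 0).

(* p lists the m vertices of a strictly convex polygon counterclockwise. *)
Definition strictly_convex_polygon (R : realType) (m : nat)
    (p : 'I_m -> 'rV[R]_2) : Prop :=
  injective p /\
  forall i j k : 'I_m, (i < j < k)%N -> 0 < orientation (p i) (p j) (p k).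

Section Triangulations.
Variables (R : realType) (n : nat) (p : 'I_n.+2 -> 'rV[R]_2).

(* The convex hull of the vertices with index in S. *)
Definition in_hull (S : {set 'I_n.+2}) (x : 'rV[R]_2) : Prop :=
  exists a : 'I_n.+2 -> R,
    [/\ forall i, i \in S -> 0 <= a i,
        \sum_(i in S) a i = 1 &
        x = \sum_(i in S) a i *: p i].

(* For affinely independent vertices, such as those of a triangle of a strictly
   convex polygon, this is the interior of the convex hull. *)
Definition in_open_hull (S : {set 'I_n.+2}) (x : 'rV[R]_2) : Prop :=
  exists a : 'I_n.+2 -> R,
    [/\ forall i, i \in S -> 0 < a i,
        \sum_(i in S) a i = 1 &
        x = \sum_(i in S) a i *: p i].

(* A triangle is given by the set of its three vertices. *)
Definition is_triangulation (T : {set {set 'I_n.+2}}) : Prop :=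
  [/\ #|T| = n,
      forall A, A \in T -> #|A| = 3%N,
      forall A B, A \in T -> B \in T -> A != B ->
        ~ (exists x, in_open_hull A x /\ in_open_hull B x) &
      forall x, in_hull [set: 'I_n.+2] x <->
        exists2 A, A \in T & in_hull A x].

End Triangulations.

(* The marked edge joins the last listed vertex to the first one; this only
   fixes where the enumeration of the vertices starts. *)
Definition marked_edge (n : nat) : {set 'I_n.+2} := [set ord0; ord_max].

(* B is the set of black triangles of T, the other triangles of T being white.
   Two triangles of a triangulation share an edge when they have exactly two
   common vertices. *)
Definition is_checkerboard (n : nat) (T B : {set {set 'I_n.+2}}) : bool :=
  [&& B \subset T,
      [forall A in T, (marked_edge n \subset A) ==> (A \in B)] &
      [forall A in T, forall A' in T,
         (#|A :&: A'| == 2%N) ==> ((A \in B) != (A' \in B))]].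

(* The checkerboard colouring of a triangulation exists and is unique, so the
   default value set0 and the choice made by pick play no role. *)
Definition black (n : nat) (T : {set {set 'I_n.+2}}) : {set {set 'I_n.+2}} :=
  odflt set0 [pick B | is_checkerboard T B].

Definition n_b (n : nat) (T : {set {set 'I_n.+2}}) : nat := #|black T|.
Definition n_w (n : nat) (T : {set {set 'I_n.+2}}) : nat := #|T :\: black T|.

(* Laurent polynomials in t are finitely supported formal sums of exponents in
   int; << 1 *g k >> is the monomial t^k and f@_k is the coefficient of t^k in
   f. The coefficients lie in int because malg asks for a zmodType; those of w
   are nonnegative by construction. *)
Definition w (R : realType) (n : nat) (p : 'I_n.+2 -> 'rV[R]_2) :
    {malg int[int]} :=
  if n == 0%N then << 1 *g 0 >>
  else \sum_(T : {set {set 'I_n.+2}} | `[< is_triangulation p T >])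
         << 1 *g (n_b T)%:Z - (n_w T)%:Z >>.

(* Main.v *)
From HB Require Import structures.
Require Import Defs.
From mathcomp Require Import all_boot all_order all_algebra.
From mathcomp Require Import boolp reals ring lra zify.

(* Cutting a triangulation along the triangle at the marked edge identifies the
   triangulations of the polygon with binary trees, the colours alternating with
   depth.  Let [f] and [g] be the generating functions of trees with a black,
   resp. white, root, where [u] marks black and [v] white nodes; thus
   [f = 1 + u g^2], [g = 1 + v f^2], and [g] is [f] with [u] and [v] exchanged.
   Differentiating these equations gives
     2 v f_v - u f_u + f = 1 / (1 - 4 u v f g) = 2 u g_u - v g_v + g,
   and comparing coefficients of [u^b v^w] is the theorem, with [n = b + w] and
   [j = b - w].
   On the geometric side, triangles with disjoint interiors have no crossing
   sides, and a family of [n] triples without crossing sides comes from a tree,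
   so the covering condition is only needed in the converse direction, where it
   follows by induction on the tree. *)

Set Implicit Arguments.
Unset Strict Implicit.
Unset Printing Implicit Defensive.

Import Order.TTheory GRing.Theory Num.Theory.
Local Open Scope ring_scope.

(** * Formal power series *)

(** The series variable will mark all nodes of a tree. With [R = {poly int}], the variable of the
    coefficients marks the black ones. *)
Definition powser (R : comNzRingType) := nat -> R.

Section PowserRing.
Variable R : comNzRingType.
Local Notation ps := (powser R).

HB.instance Definition _ := Choice.on ps.

Lemma powserP (f g : ps) : (forall n, f n = g n) -> f = g.
Proof. exact: funext. Qed.

Definition ps_add (f g : ps) : ps := fun n => f n + g n.
Definition ps_opp (f : ps) : ps := fun n => - f n.
Definition ps_const (c : R) : ps := fun n => if n == 0%N then c else 0.
Definition ps_mul (f g : ps) : ps := fun n => \sum_(a < n.+1) f a * g (n - a)%N.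

Fact ps_addA : associative ps_add.
Proof. by move=> f g h; apply: powserP => n; rewrite /ps_add addrA. Qed.
Fact ps_addC : commutative ps_add.
Proof. by move=> f g; apply: powserP => n; rewrite /ps_add addrC. Qed.
Fact ps_add0 : left_id (fun=> 0 : R) ps_add.
Proof. by move=> f; apply: powserP => n; rewrite /ps_add add0r. Qed.
Fact ps_addN : left_inverse (fun=> 0 : R) ps_opp ps_add.
Proof. by move=> f; apply: powserP => n; rewrite /ps_add /ps_opp addNr. Qed.

HB.instance Definition _ := GRing.isZmodule.Build ps ps_addA ps_addC ps_add0 ps_addN.

Definition ps_trunc (N : nat) (f : ps) : {poly R} := \poly_(i < N) f i.

(** A coefficient of a product depends on finitely many coefficients of the factors, so the ring
    laws are inherited from polynomials. *)
Lemma ps_trunc_mul N (f g : ps) n : (n < N)%N ->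
  ps_mul f g n = (ps_trunc N f * ps_trunc N g)`_n.
Proof.
move=> nN; rewrite coefM; apply: eq_bigr => -[a /= an] _.
by rewrite !coef_poly !ifT //; lia.
Qed.

Fact ps_mulC : commutative ps_mul.
Proof.
by move=> f g; apply: powserP => n; rewrite !(@ps_trunc_mul n.+1) // mulrC.
Qed.

Fact ps_mulA : associative ps_mul.
Proof.
move=> f g h; apply: powserP => n.
transitivity ((ps_trunc n.+1 f * (ps_trunc n.+1 g * ps_trunc n.+1 h))`_n).
  rewrite coefM; apply: eq_bigr => -[a /= an] _.
  by rewrite coef_poly an (@ps_trunc_mul n.+1) //; lia.
rewrite mulrA coefM; apply: eq_bigr => -[a /= an] _.
rewrite coef_poly ifT; last by lia.
by rewrite (@ps_trunc_mul n.+1).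
Qed.

Fact ps_mul1 : left_id (ps_const 1) ps_mul.
Proof.
move=> f; apply: powserP => n; rewrite /ps_mul big_ord_recl /= mul1r subn0.
by rewrite big1 ?addr0 // => i _; rewrite /ps_const /= mul0r.
Qed.

Fact ps_mulDl : left_distributive ps_mul +%R.
Proof.
move=> f g h; apply: powserP => n; rewrite /ps_mul.
under eq_bigr do rewrite mulrDl.
by rewrite big_split.
Qed.

Fact ps_1neq0 : ps_const 1 != 0 :> ps.
Proof.
apply/eqP => /(congr1 (fun f : ps => f 0%N)) /eqP.
by rewrite /ps_const /= (negPf (oner_neq0 R)).
Qed.

HB.instance Definition _ := GRing.Zmodule_isComNzRing.Build ps
  ps_mulA ps_mulC ps_mul1 ps_mulDl ps_1neq0.

Lemma psD (f g : ps) n : (f + g) n = f n + g n. Proof. by []. Qed.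
Lemma psN (f : ps) n : (- f) n = - f n. Proof. by []. Qed.
Lemma psM (f g : ps) n : (f * g) n = \sum_(a < n.+1) f a * g (n - a)%N.
Proof. by []. Qed.

Lemma psMn (f : ps) k n : (f *+ k) n = f n *+ k.
Proof. by elim: k => [|k IH]; rewrite ?mulr0n // !mulrS psD IH. Qed.

Definition ps_X : ps := fun n => if n == 1%N then 1 else 0.

Lemma ps_XM0 (f : ps) : (ps_X * f) 0%N = 0.
Proof. by rewrite psM big_ord_recl big_ord0 /= mul0r addr0. Qed.

Lemma ps_XMS (f : ps) n : (ps_X * f) n.+1 = f n.
Proof.
rewrite psM !big_ord_recl /= mul0r mul1r add0r subSS subn0.
by rewrite big1 ?addr0 // => i _; rewrite mul0r.
Qed.

Lemma ps_constM c (f : ps) n : (ps_const c * f) n = c * f n.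
Proof.
rewrite psM big_ord_recl /= subn0.
by rewrite big1 ?addr0 // => i _; rewrite mul0r.
Qed.

(** The derivation [X d/dX]; on tree series it is [u d/du + v d/dv]. *)
Definition ps_euler (f : ps) : ps := fun n => f n *+ n.

Lemma ps_eulerD f g : ps_euler (f + g) = ps_euler f + ps_euler g.
Proof. by apply: powserP => n; rewrite /ps_euler !psD mulrnDl. Qed.

Lemma ps_eulerM f g : ps_euler (f * g) = ps_euler f * g + f * ps_euler g.
Proof.
apply: powserP => n; rewrite psD /ps_euler !psM -big_split -sumrMnl /=.
apply: eq_bigr => -[a /= an] _.
by rewrite mulrnAl mulrnAr -mulrnDr subnKC.
Qed.

Definition ps_map (d : R -> R) (f : ps) : ps := fun n => d (f n).

Lemma ps_mapD (d : {additive R -> R}) f g :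
  ps_map d (f + g) = ps_map d f + ps_map d g.
Proof. by apply: powserP => n; rewrite /ps_map !psD raddfD. Qed.

Lemma ps_map_leibniz (d : {additive R -> R}) :
  (forall a b, d (a * b) = d a * b + a * d b) ->
  forall f g, ps_map d (f * g) = ps_map d f * g + f * ps_map d g.
Proof.
move=> dM f g; apply: powserP => n; rewrite psD /ps_map !psM -big_split raddf_sum.
by apply: eq_bigr => a _; rewrite dM.
Qed.

(* For [D] either partial Euler operator, differentiating [f = 1 + u g^2],
   [g = 1 + v f^2] gives [D f] and [D g] with the common denominator
   [1 - 4 u v f g]; both sides below turn out to be its inverse. *)
Lemma coupled_quadratic (S : comNzRingType) (u v f g fu fv gu gv : S) :
  f = 1 + u * g ^+ 2 -> g = 1 + v * f ^+ 2 ->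
  fu = u * g ^+ 2 + 2 * (u * g * gu) -> gu = 2 * (v * f * fu) ->
  gv = v * f ^+ 2 + 2 * (v * f * fv) -> fv = 2 * (u * g * gv) ->
  2 * fv - fu + f = 2 * gu - gv + g.
Proof.
move=> Hf Hg Hfu Hgu Hgv Hfv.
pose D := 1 - 4 * (u * v * f * g).
have Dfu : D * fu = u * g ^+ 2.
  by rewrite {1}/D mulrBl mul1r {1}Hfu Hgu; ring.
have Dgv : D * gv = v * f ^+ 2.
  by rewrite {1}/D mulrBl mul1r {1}Hgv Hfv; ring.
have Dgu : D * gu = 2 * (v * f * (u * g ^+ 2)) by rewrite Hgu -Dfu; ring.
have Dfv : D * fv = 2 * (u * g * (v * f ^+ 2)) by rewrite Hfv -Dgv; ring.
have HX : D * (2 * fv - fu + f) = 1.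
  have -> : D * (2 * fv - fu + f) = 2 * (D * fv) - D * fu + D * f by ring.
  rewrite Dfu Dfv /D.
  have -> : 2 * (2 * (u * g * (v * f ^+ 2))) - u * g ^+ 2 +
    (1 - 4 * (u * v * f * g)) * f = f - u * g ^+ 2 by ring.
  by rewrite {1}Hf; ring.
have HY : D * (2 * gu - gv + g) = 1.
  have -> : D * (2 * gu - gv + g) = 2 * (D * gu) - D * gv + D * g by ring.
  rewrite Dgv Dgu /D.
  have -> : 2 * (2 * (v * f * (u * g ^+ 2))) - v * f ^+ 2 +
    (1 - 4 * (u * v * f * g)) * g = g - v * f ^+ 2 by ring.
  by rewrite {1}Hg; ring.
transitivity ((D * (2 * fv - fu + f)) * (2 * gu - gv + g)).
  by rewrite -mulrA mulrCA HY mulr1.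
by rewrite HX mul1r.
Qed.

End PowserRing.

(** * Coloured binary trees *)

Inductive bintree := Leaf | Node of bintree & bintree.

HB.instance Definition _ := gen_eqMixin bintree.

Fixpoint nodes (t : bintree) : nat :=
  if t is Node l r then (nodes l + nodes r).+1 else 0%N.

(** Counts black nodes, [true] being black and [c] the colour of the root. *)
Fixpoint coloured (c : bool) (t : bintree) : nat :=
  if t is Node l r then (c + coloured (~~ c) l + coloured (~~ c) r)%N else 0%N.

Lemma coloured_negb c t : (coloured c t + coloured (~~ c) t = nodes t)%N.
Proof.
elim: t c => //= l IHl r IHr c; rewrite -(IHl c) -(IHr c) negbK.
by case: c => /=; lia.
Qed.

(* [d] is recursion fuel: the value does not depend on it once [n <= d]. *)
Fixpoint trees_upto (d n : nat) : seq bintree :=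
  match d, n with
  | _, 0%N => [:: Leaf]
  | d'.+1, n'.+1 =>
      [seq Node lr.1 lr.2 |
        lr <- flatten [seq [seq (l, r) | l <- trees_upto d' a,
                                         r <- trees_upto d' (n' - a)]
                      | a <- iota 0 n'.+1]]
  | 0%N, _ => [::]
  end.

Lemma trees_uptoS d n : trees_upto d.+1 n.+1 =
  [seq Node lr.1 lr.2 |
    lr <- flatten [seq [seq (l, r) | l <- trees_upto d a,
                                     r <- trees_upto d (n - a)]
                  | a <- iota 0 n.+1]].
Proof. by []. Qed.

Definition trees n := trees_upto n n.

Lemma trees_upto_stable d n : (n <= d)%N -> trees_upto d n = trees n.
Proof.
rewrite /trees; elim/ltn_ind: n d => -[|n] IH [|d] // nd.
rewrite !trees_uptoS.
congr (map _ (flatten _)); apply/eq_in_map => a; rewrite mem_iota => /andP[_ an].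
by rewrite !(IH a) ?(IH (n - a)%N) //; lia.
Qed.

Lemma trees0 : trees 0 = [:: Leaf]. Proof. by []. Qed.

Lemma treesS n : trees n.+1 =
  [seq Node lr.1 lr.2 |
    lr <- flatten [seq [seq (l, r) | l <- trees a, r <- trees (n - a)]
                  | a <- iota 0 n.+1]].
Proof.
rewrite {1}/trees trees_uptoS; congr (map _ (flatten _)); apply/eq_in_map => a.
by rewrite mem_iota => /andP[_ an]; rewrite !trees_upto_stable //; lia.
Qed.

Lemma mem_trees n t : (t \in trees n) = (nodes t == n).
Proof.
elim/ltn_ind: n t => -[|n] IH t.
  by rewrite trees0 inE; case: t => [|l r] /=; apply/eqP.
rewrite treesS; apply/mapP/eqP.
  move=> [lr /flattenP[s /mapP[a]]]; rewrite mem_iota => /andP[_ an] ->.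
  case/allpairsP => -[l r] /= [lt rt ->] ->.
  by move: lt rt; rewrite /= !IH; [move=> /eqP -> /eqP ->; lia|lia..].
case: t => // l r [nlr]; exists (l, r) => //; apply/flattenP.
exists [seq (l', r') | l' <- trees (nodes l), r' <- trees (n - nodes l)].
  by apply/mapP; exists (nodes l) => //; rewrite mem_iota; lia.
by apply/allpairsP; exists (l, r); rewrite /= !IH; [split => //; lia|lia..].
Qed.

Lemma uniq_trees n : uniq (trees n).
Proof.
elim/ltn_ind: n => -[|n] IH; first by rewrite trees0.
rewrite treesS map_inj_uniq => [|[l r] [l' r'] [-> ->] //].
(* The range of left sizes is generalised to any duplicate-free list of sizes at most [n], for an
   induction on that list. *)
have : {subset iota 0 n.+1 <= gtn n.+1} by move=> a; rewrite mem_iota.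
have := iota_uniq 0 n.+1; elim: (iota _ _) => //= a s IHs /andP[as_ us] sub.
rewrite cat_uniq IHs // => [|b bs]; last by apply: sub; rewrite inE bs orbT.
have an : (a < n.+1)%N by apply: (sub a); rewrite mem_head.
rewrite andbT; apply/andP; split.
  by apply: allpairs_uniq => [||[? ?] [? ?] _ _ //]; apply: IH; lia.
apply/hasPn => lr /flattenP[_ /mapP[b bs ->]] /allpairsP[[l r] /= [lb _ ->]].
apply/negP => /allpairsP[[l' r'] /= [la _ [ll' _]]].
move: lb la; rewrite -ll' !mem_trees => /eqP lb /eqP la.
by move: as_; rewrite -la lb bs.
Qed.

(** * Generating functions of coloured trees and their reciprocity *)

Section Count.

Definition colour_gf (c : bool) : powser {poly int} :=
  fun n => \sum_(t <- trees n) 'X ^+ coloured c t.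

Local Notation ps := (powser {poly int}).
Local Notation X := (@ps_X {poly int}).
Local Notation C := (@ps_const {poly int}).

(** A nonempty tree is a root of weight [X * C ('X ^+ c)] with two subtrees whose roots have the
    other colour. *)
Lemma colour_gf_rec c :
  colour_gf c = 1 + X * C ('X ^+ c) * colour_gf (~~ c) ^+ 2.
Proof.
apply: powserP => -[|n]; rewrite psD -mulrA.
  by rewrite ps_XM0 addr0 /colour_gf trees0 big_seq1.
rewrite ps_XMS ps_constM expr2 psM add0r mulr_sumr.
rewrite /colour_gf treesS big_map big_flatten big_map.
rewrite -[n.+1]subn0 -/(index_iota 0 n.+1) big_mkord.
apply: eq_bigr => -[a /= an] _; rewrite big_allpairs mulr_suml mulr_sumr.
apply: eq_bigr => l _; rewrite !mulr_sumr; apply: eq_bigr => r _ /=.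
by rewrite !exprD mulrA.
Qed.

(** Applied to each coefficient of a series, this is the derivation [u d/du]. *)
Definition mulX_deriv (q : {poly int}) : {poly int} := 'X * q^`().

Fact mulX_deriv_additive : additive mulX_deriv.
Proof. by move=> p q; rewrite /mulX_deriv derivB mulrBr. Qed.
HB.instance Definition _ :=
  GRing.isZmodMorphism.Build _ _ mulX_deriv mulX_deriv_additive.

Lemma mulX_derivM p q : mulX_deriv (p * q) = mulX_deriv p * q + p * mulX_deriv q.
Proof. by rewrite /mulX_deriv derivM; ring. Qed.

Definition count_trees n b : int :=
  (count (fun t => coloured true t == b) (trees n))%:Z.

Lemma coef_colour_gf c n b :
  (colour_gf c n)`_b = (count (fun t => coloured c t == b) (trees n))%:Z.
Proof.
rewrite /colour_gf coef_sum -sum1_count -natz natr_sum [RHS]big_mkcond /=.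
by apply: eq_bigr => t _; rewrite coefXn eq_sym; case: eqP.
Qed.

Lemma coef_mulX_deriv q b : (mulX_deriv q)`_b = q`_b *+ b.
Proof. by case: b => [|b]; rewrite /mulX_deriv coefXM //= coef_deriv. Qed.

(** The black nodes for one colour of the root are the white nodes for the other. *)
Lemma count_trees_swap n b :
  (b <= n)%N ->
  count (fun t => coloured false t == b) (trees n) =
  count (fun t => coloured true t == n - b)%N (trees n).
Proof.
move=> bn; apply: eq_in_count => t; rewrite mem_trees => /eqP tn.
by have := coloured_negb true t; rewrite tn /=; lia.
Qed.

Lemma ps_eulerX : ps_euler X = X.
Proof.
by apply: powserP => -[|[|n]]; rewrite /ps_euler /ps_X //= mul0rn.
Qed.

Lemma ps_euler_const q : ps_euler (C q) = 0.
Proof. by apply: powserP => -[|n]; rewrite /ps_euler /ps_const //= mul0rn. Qed.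

Local Notation DT := (ps_map mulX_deriv).

Lemma ps_mapX : DT X = 0.
Proof.
by apply: powserP => -[|[|n]]; rewrite /ps_map /ps_X /mulX_deriv //=
  -?polyC1 ?derivC ?mulr0.
Qed.

Lemma ps_map_const q : DT (C q) = C (mulX_deriv q).
Proof.
by apply: powserP => -[|n]; rewrite /ps_map /ps_const //= /mulX_deriv deriv0 mulr0.
Qed.

(** On the term with [b] black and [w] white nodes, [u d/du] acts as multiplication by [b] and
    [v d/dv] by [w]. Comparing this coefficient in [coupled_quadratic] gives the identity, once
    [count_trees_swap] has turned white roots into black ones. *)
Lemma count_trees_reciprocity n b w : (b + w = n)%N ->
  (2 * w%:Z + 1 - b%:Z) * count_trees n b = (2 * b%:Z + 1 - w%:Z) * count_trees n w.
Proof.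
(* Since [X] marks every node and ['X] the black ones, [u] below marks black nodes and [v] white
   nodes. *)
move=> bwn; pose f := colour_gf true; pose g := colour_gf false.
pose u := X * C 'X; pose v := X : ps.
have Hf : f = 1 + u * g ^+ 2 by rewrite /f colour_gf_rec.
have Hg : g = 1 + v * f ^+ 2.
  rewrite /g colour_gf_rec /v /= expr0; congr (1 + _ * _).
  by rewrite -[RHS]mulr1.
have D1 (D : ps -> ps) : (forall f g, D (f * g) = D f * g + f * D g) -> D 1 = 0.
  by move=> DM; apply: (@addrI _ (D 1)); rewrite addr0 -{3}[1]mulr1 DM mulr1 mul1r.
have EM := @ps_eulerM {poly int}.
have TM (h k : ps) : DT (h * k) = DT h * k + h * DT k.
  exact: (@ps_map_leibniz _ mulX_deriv mulX_derivM).
have TD (h k : ps) : DT (h + k) = DT h + DT k by exact: (@ps_mapD _ mulX_deriv).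
have Tu : DT u = u.
  by rewrite /u TM ps_mapX mul0r add0r ps_map_const /mulX_deriv derivX mulr1.
have Eu : ps_euler u = u by rewrite /u EM ps_eulerX ps_euler_const mulr0 addr0.
have Tv : DT v = 0 by exact: ps_mapX.
have Ev : ps_euler v = v by exact: ps_eulerX.
clearbody u v.
have Tf : DT f = u * g ^+ 2 + 2 * (u * g * DT g).
  by rewrite {1}Hf TD D1 // !expr2 !TM Tu; ring.
have Tg : DT g = 2 * (v * f * DT f).
  by rewrite {1}Hg TD D1 // !expr2 !TM Tv; ring.
have Ef : ps_euler f = u * g ^+ 2 + 2 * (u * g * ps_euler g).
  by rewrite {1}Hf (@ps_eulerD {poly int}) D1 // !expr2 !EM Eu; ring.
have Eg : ps_euler g = v * f ^+ 2 + 2 * (v * f * ps_euler f).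
  by rewrite {1}Hg (@ps_eulerD {poly int}) D1 // !expr2 !EM Ev; ring.
(* The difference [ps_euler - DT] is [v d/dv]. *)
have Vg : ps_euler g - DT g = v * f ^+ 2 + 2 * (v * f * (ps_euler f - DT f)).
  by rewrite Eg {1}Tg; ring.
have Vf : ps_euler f - DT f = 2 * (u * g * (ps_euler g - DT g)).
  by rewrite {1}Ef {1}Tf; ring.
have /(congr1 (fun h : ps => (h n)`_b)) H := coupled_quadratic Hf Hg Tf Tg Vg Vf.
rewrite !mulr_natl !(psD, psN, psMn, coefD, coefN, coefMn) in H.
rewrite /ps_map /ps_euler !coef_mulX_deriv !coef_colour_gf in H.
rewrite count_trees_swap in H; last by rewrite -bwn leq_addr.
have nbw : (n - b = w)%N by rewrite -bwn addKn.
rewrite nbw -/(count_trees n b) -/(count_trees n w) in H.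
move: (count_trees n b) (count_trees n w) H => A B.
by rewrite -bwn => H; apply: etrans (etrans _ H) _; ring.
Qed.

End Count.

(** * Trees as non-crossing families of triangles *)

Section Faces.
Local Open Scope nat_scope.
Variable n : nat.
Local Notation V := 'I_n.+2.

(** Vertices are natural numbers sent through [inord], so that comparing their positions is plain
    arithmetic. *)
Definition tri (x y z : nat) : {set V} := [set inord x; inord y; inord z].

Definition tri_in (i j : nat) (A : {set V}) : Prop :=
  exists x y z, [/\ i <= x, x < y < z, z <= j & A = tri x y z].

Definition between (i j : nat) : {set V} := [set v : V | i <= v <= j].

Lemma in_tri x y z (v : V) : x < n.+2 -> y < n.+2 -> z < n.+2 ->
  (v \in tri x y z) = [|| v == x :> nat, v == y :> nat | v == z :> nat].
Proof. by move=> xn yn zn; rewrite !inE -!val_eqE /= !inordK // orbA. Qed.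

Lemma card_tri x y z : x < y < z -> z < n.+2 -> #|tri x y z| = 3.
Proof.
move=> /andP[xy yz] zn; rewrite /tri setUC cardsU1 cards2 !inE -!val_eqE /=.
by rewrite !inordK; lia.
Qed.

Lemma card3_tri (A : {set V}) : #|A| = 3 -> tri_in 0 n.+1 A.
Proof.
move=> A3; have /card_gt0P[a aA] : 0 < #|A| by rewrite A3.
have : #|A :\ a| == 2 by move: (cardsD1 a A); rewrite aA; lia.
case/cards2P => b [c [bc Ebc]].
have ab : a != b by have := setD11 a A; rewrite Ebc !inE; case: eqP.
have ac : a != c.
  by have := setD11 a A; rewrite Ebc !inE => /negbT; rewrite negb_or => /andP[].
have {aA}EA : A = [set a; b; c] by rewrite -(setD1K aA) Ebc setUA.
have xP (x y z : V) : A = [set x; y; z] -> x < y < z -> tri_in 0 n.+1 A.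
  move=> -> xyz; exists x, y, z; rewrite /tri !inord_val; split => //.
  by rewrite -ltnS ltn_ord.
have S1 (x y z : V) : [set x; y; z] = [set y; x; z].
  by rewrite (setUC [set x]).
have S2 (x y z : V) : [set x; y; z] = [set x; z; y].
  by rewrite -!setUA (setUC [set y]).
move: ab ac bc; rewrite -!val_eqE /=.
case: (ltngtP a b) => // ab _; case: (ltngtP a c) => // ac _;
  case: (ltngtP b c) => // bc _; try lia.
- by apply: (xP a b c); rewrite ?ab.
- by apply: (xP a c b); rewrite ?ac // S2.
- by apply: (xP c a b); rewrite ?ac // S1 S2.
- by apply: (xP b a c); rewrite ?ab // S1.
- by apply: (xP b c a); rewrite ?bc // S2 S1.
- by apply: (xP c b a); rewrite ?bc // S1 S2 S1.
Qed.

Lemma tri_in_sub i j (A : {set V}) : j < n.+2 -> tri_in i j A -> A \subset between i j.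
Proof.
move=> jn [x [y [z [ix xyz zj ->]]]]; apply/subsetP => v.
by rewrite in_tri ?inE; lia.
Qed.

Lemma tri_in_narrow i j i' j' (A : {set V}) : j < n.+2 ->
  tri_in i j A -> A \subset between i' j' -> tri_in i' j' A.
Proof.
move=> jn [x [y [z [ix xyz zj ->]]]] /subsetP sub.
have := sub (inord x); have := sub (inord z).
rewrite !in_tri ?inE ?inordK ?eqxx ?orbT; try lia.
by move=> /(_ isT) ? /(_ isT) ?; exists x, y, z; split=> //; lia.
Qed.

Lemma tri_in_widen i j i' j' (A : {set V}) :
  i' <= i -> j <= j' -> tri_in i j A -> tri_in i' j' A.
Proof. by move=> ? ? [x [y [z [? ? ? ->]]]]; exists x, y, z; split=> //; lia. Qed.

(** The two ranges share only the vertex [k]. *)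
Lemma tri_in_disjoint i k j (A : {set V}) : j < n.+2 -> k < n.+2 ->
  tri_in i k A -> tri_in k j A -> False.
Proof.
move=> jn kn [x [y [z [ix xyz zk ->]]]] [x' [y' [z' [ix' xyz' zk' E]]]].
have : inord x \in tri x' y' z' by rewrite -E in_tri ?inordK ?eqxx //; lia.
by rewrite in_tri ?inordK; lia.
Qed.

(** A tree with [m] nodes describes the polygon on the [m + 2] consecutive vertices from [i], its
    base joining the first to the last. The apex [k] of the root triangle leaves [nodes l + 2]
    vertices from [i] to [k]; a leaf is a bare edge. *)
Fixpoint faces (t : bintree) (i : nat) : {set {set V}} :=
  if t is Node l r then
    let k := i + (nodes l).+1 in
    tri i k (k + (nodes r).+1) |: (faces l i :|: faces r k)
  else set0.

(* [inord] returns junk beyond [n.+1]; [fits t i] rules this out for the vertices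
   [i, ..., i + nodes t + 1] of [faces t i]. *)
Definition fits t i := i + (nodes t).+1 < n.+2.

Lemma fits_node l r i : fits (Node l r) i ->
  [/\ fits l i, fits r (i + (nodes l).+1) &
      i + (nodes (Node l r)).+1 = i + (nodes l).+1 + (nodes r).+1].
Proof. by rewrite /fits /= => ?; split; lia. Qed.

Lemma faces_in t i A : fits t i -> A \in faces t i ->
  tri_in i (i + (nodes t).+1) A.
Proof.
elim: t i => [|l IHl r IHr] i; first by rewrite inE.
move=> /fits_node[fl fr /= Ej]; rewrite !inE => /orP[/eqP ->|/orP[Al|Ar]].
- by eexists _, _, _; split; [| |  |reflexivity]; lia.
- by apply: tri_in_widen (IHl _ fl Al); lia.
- by apply: tri_in_widen (IHr _ fr Ar); lia.
Qed.

Variant node_face_spec l r i A : Prop :=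
| RootFace of A = tri i (i + (nodes l).+1) (i + (nodes l).+1 + (nodes r).+1)
| LeftFace of A \in faces l i & tri_in i (i + (nodes l).+1) A
| RightFace of A \in faces r (i + (nodes l).+1) &
    tri_in (i + (nodes l).+1) (i + (nodes l).+1 + (nodes r).+1) A.

Lemma node_faceP l r i A : fits (Node l r) i -> A \in faces (Node l r) i ->
  node_face_spec l r i A.
Proof.
move=> /fits_node[fl fr _]; rewrite !inE => /orP[/eqP|/orP[]] HA.
- exact: RootFace.
- by apply: LeftFace => //; apply: faces_in.
- by apply: RightFace => //; apply: faces_in.
Qed.

Section Node.
Variables (l r : bintree) (i : nat).
Let k := i + (nodes l).+1.
Let j := k + (nodes r).+1.
Hypothesis ft : fits (Node l r) i.

Lemma root_in : tri i k j \in faces (Node l r) i.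
Proof. by rewrite !inE eqxx. Qed.

Lemma left_in A : A \in faces l i -> A \in faces (Node l r) i.
Proof. by rewrite !inE => ->; rewrite orbT. Qed.

Lemma right_in A : A \in faces r k -> A \in faces (Node l r) i.
Proof. by rewrite !inE => ->; rewrite !orbT. Qed.

Lemma root_notin_left : tri i k j \notin faces l i.
Proof.
have [fl _ Ej] := fits_node ft; move: (ft); rewrite /fits Ej => jn.
apply/negP => /(faces_in fl) /tri_in_sub => /(_ fl) /subsetP /(_ (inord j)).
by rewrite in_tri ?inE ?inordK; rewrite /j /k; lia.
Qed.

Lemma root_notin_right : tri i k j \notin faces r k.
Proof.
have [fl fr Ej] := fits_node ft; move: (ft); rewrite /fits Ej => jn.
apply/negP => /(faces_in fr) /tri_in_sub => /(_ fr) /subsetP /(_ (inord i)).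
by rewrite in_tri ?inE ?inordK; rewrite /j /k; lia.
Qed.

Lemma left_right_disjoint A : A \in faces l i -> A \notin faces r k.
Proof.
have [fl fr Ej] := fits_node ft => /(faces_in fl) Al.
by apply/negP => /(faces_in fr); apply: tri_in_disjoint Al.
Qed.

Lemma card_node (B : {set {set V}}) : B \subset faces (Node l r) i ->
  #|B| = (tri i k j \in B) + #|B :&: faces l i| + #|B :&: faces r k|.
Proof.
move=> sB; rewrite (cardsD1 (tri i k j)) -addnA; congr addn.
have D0 : B :&: faces l i :&: (B :&: faces r k) = set0.
  apply/setP => A; rewrite !inE; case: (boolP (A \in faces l i)) => [Al|].
    by rewrite (negPf (left_right_disjoint Al)) !andbF.
  by rewrite andbF.
rewrite -cardsUI D0 cards0 addn0.
apply: eq_card => A; rewrite !inE -andb_orr.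
case: (boolP (A \in B)) => AB; rewrite ?andbF ?andbT //.
have := subsetP sB A AB; rewrite !inE; case: eqP => [-> _|] //=.
by rewrite (negPf root_notin_left) (negPf root_notin_right).
Qed.

(** Recovers the left subtree's faces from the whole family and the apex alone, which the
    injectivity of [faces] relies on. *)
Lemma faces_leftE : faces l i =
  [set A in faces (Node l r) i | A \subset between i k].
Proof.
have [fl fr Ej] := fits_node ft; apply/setP => A; rewrite [RHS]inE.
apply/idP/andP => [Al|[/(node_faceP ft)[->|//|Ar Tr] sA]].
- by split; [apply: left_in|apply/tri_in_sub/faces_in].
- move: (ft); rewrite /fits Ej => jn; have := subsetP sA (inord j).
  by rewrite in_tri ?inE ?inordK; rewrite /j /k; lia.
- by case: (@tri_in_disjoint i k j A) => //; apply: tri_in_narrow Tr sA.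
Qed.

Lemma faces_rightE : faces r k =
  [set A in faces (Node l r) i | A \subset between k j].
Proof.
have [fl fr Ej] := fits_node ft; apply/setP => A; rewrite [RHS]inE.
apply/idP/andP => [Ar|[/(node_faceP ft)[->|Al Tl|//] sA]].
- by split; [apply: right_in|apply/tri_in_sub/faces_in].
- move: (ft); rewrite /fits Ej => jn; have := subsetP sA (inord i).
  by rewrite in_tri ?inE ?inordK; rewrite /j /k; lia.
- by case: (@tri_in_disjoint i k j A) => //; apply: tri_in_narrow Tl sA.
Qed.

(** Faces of the left subtree miss the vertex [j], those of the right subtree miss [i]. *)
Lemma root_unique A : A \in faces (Node l r) i ->
  inord i \in A -> inord j \in A -> A = tri i k j.
Proof.
have [fl fr Ej] := fits_node ft; move: (ft); rewrite /fits Ej => jn.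
move=> /(node_faceP ft)[//|_ /tri_in_sub|_ /tri_in_sub] => /(_ _)/subsetP sA iA jA.
- by have := sA fl _ jA; rewrite inE inordK; rewrite /j /k; lia.
- by have := sA jn _ iA; rewrite inE inordK; rewrite /j /k; lia.
Qed.

End Node.

Lemma card_faces t i : fits t i -> #|faces t i| = nodes t.
Proof.
elim: t i => [|l IHl r IHr] i ft; first by rewrite cards0.
have [fl fr _] := fits_node ft.
rewrite (card_node ft (subxx _)) root_in.
have /setIidPr -> : faces l i \subset faces (Node l r) i.
  by apply/subsetP => A; apply: left_in.
have /setIidPr -> : faces r (i + (nodes l).+1) \subset faces (Node l r) i.
  by apply/subsetP => A; apply: right_in.
by rewrite IHl // IHr //= add1n.
Qed.

(** The only face on the base determines the apex, hence the sizes of both subtrees; their faces are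
    then those lying on each side of the apex. *)
Lemma faces_inj t t' i : fits t i -> nodes t = nodes t' ->
  faces t i = faces t' i -> t = t'.
Proof.
elim: t t' i => [|l IHl r IHr] [|l' r'] i ft //= [Hn] E.
have ft' : fits (Node l' r') i by move: ft; rewrite /fits /= Hn.
have [fl fr Ej] := fits_node ft; have [_ _ Ej'] := fits_node ft'.
move: (ft); rewrite /fits Ej => jn.
have Hj : i + (nodes l).+1 + (nodes r).+1 = i + (nodes l').+1 + (nodes r').+1 by lia.
have Hl : nodes l = nodes l'.
  have := root_unique ft' (A := tri i (i + (nodes l).+1) (i + (nodes l).+1 + (nodes r).+1)).
  rewrite -[faces (Node l' r') i]E root_in -Hj !in_tri ?inordK; try lia.
  rewrite !eqxx ?orbT => /(_ isT isT isT) /setP /(_ (inord (i + (nodes l).+1))).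
  by rewrite !in_tri ?inordK; lia.
have Hr : nodes r = nodes r' by lia.
move: (E); have -> := IHl l' i fl Hl _; last first.
  rewrite (faces_leftE ft) (faces_leftE ft') Hl.
  by rewrite -[faces (Node l' r') i]E.
have -> // := IHr r' (i + (nodes l).+1) fr Hr _.
have -> : faces r' (i + (nodes l).+1) = faces r' (i + (nodes l').+1) by rewrite Hl.
rewrite (faces_rightE ft) (faces_rightE ft') -Hl -Hr.
by rewrite -[faces (Node l' r') i]E.
Qed.

(** * Maximal families of pairwise noncrossing triangles *)

Definition noncrossing (A B : {set V}) : Prop :=
  forall a b c d, a < b < c -> c < d < n.+2 ->
    inord a \in A -> inord c \in A -> inord b \in B -> inord d \in B -> False.

Lemma tri_vertices x y z : x < y < z -> z < n.+2 ->
  [/\ inord x \in tri x y z, inord y \in tri x y z & inord z \in tri x y z].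
Proof. by move=> *; rewrite !in_tri ?inordK ?eqxx ?orbT //; lia. Qed.

(** Named so that it can be assumed on both sides of a splitting vertex. [noncrossing] is asked for
    both orders of a pair, as it excludes only the alternations that start in its first argument. *)
Definition max_noncrossing d : Prop := forall i (T : {set {set V}}),
  i + d.+1 < n.+2 -> (forall A, A \in T -> tri_in i (i + d.+1) A) ->
  (forall A B, A \in T -> B \in T -> noncrossing A B) ->
  #|T| <= d /\ (#|T| = d -> exists2 t, nodes t = d & T = faces t i).

(** The triangles on the two sides of [k] are bounded separately, and reaching the sum of the bounds
    forces equality in each. *)
Lemma max_noncrossing_split e f i (T : {set {set V}}) :
  let k := i + e.+1 in
  max_noncrossing e -> max_noncrossing f ->
  k + f.+1 < n.+2 ->
  (forall A, A \in T -> tri_in i k A \/ tri_in k (k + f.+1) A) ->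
  (forall A B, A \in T -> B \in T -> noncrossing A B) ->
  #|T| <= e + f /\
  (#|T| = e + f -> exists l r, [/\ nodes l = e, nodes r = f &
                                T = faces l i :|: faces r k]).
Proof.
move=> k IHe IHf jn Tin Tnc.
pose T1 := T :&: [set A : {set V} | A \subset between i k].
pose T2 := T :\: [set A : {set V} | A \subset between i k].
have T1in A : A \in T1 -> A \in T /\ tri_in i k A.
  rewrite !inE => /andP[AT sA]; split=> //; case: (Tin A AT) => // /tri_in_narrow.
  by apply.
have T2in A : A \in T2 -> A \in T /\ tri_in k (k + f.+1) A.
  rewrite !inE => /andP[sA AT]; split=> //; case: (Tin A AT) => // /tri_in_sub sA'.
  by rewrite sA' // in sA; lia.
have [c1 e1] : #|T1| <= e /\ (#|T1| = e -> exists2 t, nodes t = e & T1 = faces t i).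
  apply: IHe; first by rewrite -/k; lia.
    by move=> A /T1in[].
  by move=> A B /T1in[? _] /T1in[? _]; apply: Tnc.
have [c2 e2] : #|T2| <= f /\ (#|T2| = f -> exists2 t, nodes t = f & T2 = faces t k).
  apply: IHf => // [A /T2in[] //|A B /T2in[? _] /T2in[? _]]; exact: Tnc.
have cT : #|T| = #|T1| + #|T2|.
  by rewrite -(cardsID [set A : {set V} | A \subset between i k] T).
rewrite cT; split; first exact: leq_add.
move=> c12; have [E1 E2] : #|T1| = e /\ #|T2| = f.
  by move: #|T1| #|T2| c1 c2 c12; lia.
have [l nl El] := e1 E1; have [r nr Er] := e2 E2.
by exists l, r; split=> //; rewrite -El -Er setID.
Qed.

(** A triangle on the base splits all others at its apex and adds one to the bounds of the two
    sides. Without such a triangle some vertex still splits the family, but the bound is then one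
    smaller, so equality cannot occur. *)
Lemma max_noncrossingP d : max_noncrossing d.
Proof.
elim/ltn_ind: d => -[|d] IH i T jn Tin Tnc.
  have T0 : T = set0.
    apply/setP => A; rewrite inE; apply/negP => /Tin[x [y [z [? ? ? _]]]]; lia.
  by rewrite T0 cards0; split=> // _; exists Leaf.
pose j := i + d.+2.
have [[A0 A0T /andP[iA0 jA0]]|noroot] :=
    @exists_inP _ (mem T) (fun A : {set V} => (inord i \in A) && (inord j \in A)).
  have [x [y [z [ix xyz zj EA0]]]] := Tin _ A0T.
  have zn : z < n.+2 by lia.
  rewrite EA0 !in_tri ?inordK in iA0 jA0; try (rewrite /j; lia).
  have xi : x = i by lia.
  have zj' : z = j by rewrite /j in jA0 *; lia.
  subst x z; have [iA yA jA] := tri_vertices xyz zn.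
  pose e := (y - i).-1; pose f := (j - y).-1.
  have Ey : y = i + e.+1 by rewrite /e; lia.
  have Ej : j = y + f.+1 by rewrite /f /j; lia.
  have def : d = e + f by rewrite /j in Ej; lia.
  have [| | | | |c E] := @max_noncrossing_split e f i (T :\ A0).
  - by apply: IH; lia.
  - by apply: IH; lia.
  - by rewrite -Ey -Ej; lia.
  - move=> B; rewrite 2!inE => /andP[BA0 BT]; rewrite -Ey -Ej.
    have [a [b [c [ia abc cj EB]]]] := Tin _ BT.
    have cn : c < n.+2 by lia.
    have [aB bB cB] := tri_vertices abc cn; rewrite -EB in aB bB cB.
    rewrite -EA0 in iA yA jA.
    case: (leqP c y) => [cy|yc]; first by left; exists a, b, c; split.
    case: (leqP y a) => [ya|ay]; first by right; exists a, b, c; split.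
    (* In the remaining case [a < y < c], a side of [B] crosses a side of [A0], or [B] is [A0]. *)
    case: (ltnP i a) => [i_a|ai].
      by case: (Tnc A0 B A0T BT i a y c) => //; lia.
    have Ea : a = i by lia.
    case: (ltnP c j) => [c_j|jc].
      by case: (Tnc B A0 BT A0T a y c j) => //; rewrite ?Ea //; lia.
    have Ec : c = j by rewrite /j; lia.
    subst a c; case: (ltngtP b y) => [b_y|y_b|Eb].
    + by case: (Tnc A0 B A0T BT i b y j) => //; lia.
    + by case: (Tnc B A0 BT A0T i y b j) => //; lia.
    + by rewrite EB EA0 Eb eqxx in BA0.
  - by move=> A B; rewrite !inE => /andP[_ ?] /andP[_ ?]; apply: Tnc.
  have -> : #|T| = #|T :\ A0|.+1 by rewrite (cardsD1 A0 T) (A0T : A0 \in T).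
  split; first by rewrite def ltnS.
  move=> [cT]; have [l [r [nl nr Elr]]] := E (etrans cT def).
  exists (Node l r) => /=; first by lia.
  by rewrite -(setD1K A0T) Elr EA0 nl nr -Ey -Ej.
suff [k [ik kj HT]] : exists k, [/\ i < k, k < j &
    forall B, B \in T -> tri_in i k B \/ tri_in k j B].
  pose e := (k - i).-1; pose f := (j - k).-1.
  have Ek : k = i + e.+1 by rewrite /e; lia.
  have Ej : j = k + f.+1 by rewrite /f /j; lia.
  have def : d = e + f by rewrite /j in Ej; lia.
  have [| | | | |c E] := @max_noncrossing_split e f i T.
  - by apply: IH; lia.
  - by apply: IH; lia.
  - by rewrite -Ek -Ej.
  - by rewrite -Ek -Ej.
  - exact: Tnc.
  have lt : #|T| < d.+1 by rewrite def ltnS.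
  by split=> [|cT]; [exact: ltnW|rewrite cT ltnn in lt].
(* The splitting vertex is the farthest [k] sharing a triangle with [i]: a triangle with vertices on
   both sides of [k] would cross the chord from [i] to [k] or join [i] to a farther vertex. The
   bound [k < n.+2] excludes default values of [inord]. *)
pose Q k := (i < k) && [exists A in T, (inord i \in A) && (inord k \in A) && (k < n.+2)].
have Qbound k : Q k -> k < j.
  move=> /andP[ik /exists_inP[A AT /andP[/andP[iA kA] kn]]].
  have := subsetP (tri_in_sub jn (Tin A AT)) _ kA; rewrite inE inordK // => /andP[_].
  rewrite leq_eqVlt -/j => /orP[/eqP kj|//].
  by case: noroot; exists A; rewrite // iA -kj kA.
have [exQ|nQ] := pselect (exists k, Q k).
  have [k Qk kmax] := ex_maxnP exQ (fun k Qk => ltnW (Qbound k Qk)).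
  exists k; have kj := Qbound k Qk.
  have /andP[ik /exists_inP[A AT /andP[/andP[iA kA] kn]]] := Qk.
  split=> // B BT; have [a [b [c [ia abc cj EB]]]] := Tin _ BT.
  have cn : c < n.+2 by lia.
  have [aB bB cB] := tri_vertices abc cn; rewrite -EB in aB bB cB.
  case: (leqP c k) => [ck|kc]; first by left; exists a, b, c; split.
  case: (leqP k a) => [ka|ak]; first by right; exists a, b, c; split.
  case: (ltnP i a) => [i_a|ai].
    by case: (Tnc A B AT BT i a k c) => //; lia.
  have Ea : a = i by lia.
  suff /kmax : Q c by lia.
  apply/andP; split; first by lia.
  by apply/exists_inP; exists B; rewrite // -Ea aB cB.
(* Here no triangle contains [i], so all of them lie to the right of [i.+1]. *)
exists i.+1; split=> //; rewrite /j; first by lia.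
move=> B BT; right; have [a [b [c [ia abc cj EB]]]] := Tin _ BT.
have cn : c < n.+2 by lia.
have [aB bB cB] := tri_vertices abc cn; rewrite -EB in aB bB cB.
exists a, b, c; split=> //; rewrite ltn_neqAle ia andbT; apply/eqP => Ea.
case: nQ; exists c; apply/andP; split; first by lia.
by apply/exists_inP; exists B; rewrite // Ea aB cB.
Qed.

(** * Checkerboard colourings, by recursion on the tree with the colour [c] of the base triangle as
    a parameter *)

Definition proper_colouring c i j (T B : {set {set V}}) : Prop :=
  [/\ B \subset T,
      forall A, A \in T -> inord i \in A -> inord j \in A -> (A \in B) = c &
      forall A A', A \in T -> A' \in T -> #|A :&: A'| = 2 ->
        (A \in B) != (A' \in B)].

Section ColourNode.
Variables (l r : bintree) (i : nat).
Let k := i + (nodes l).+1.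
Let j := k + (nodes r).+1.
Hypothesis ft : fits (Node l r) i.

(** A face of the left subtree has its vertices between [i] and [k], so it can share only these two
    with the root triangle. *)
Lemma root_left_adjacent A : A \in faces l i ->
  #|tri i k j :&: A| = 2 <-> inord i \in A /\ inord k \in A.
Proof.
have [fl fr Ej] := fits_node ft; move: (ft); rewrite /fits Ej -/k -/j => jn.
move=> /(faces_in fl) /tri_in_sub => /(_ fl) /subsetP sA.
have ik : i < k by rewrite /k; lia.
have kj : k < j by rewrite /j; lia.
have sI : tri i k j :&: A \subset [set inord i; inord k].
  apply/subsetP => v; rewrite inE in_tri; try lia.
  move=> /andP[vt /sA]; rewrite inE -/k !inE -!val_eqE /= !inordK; lia.
have c2 : #|[set (inord i : V); inord k]| = 2.
  by rewrite cards2 -val_eqE /= !inordK; lia.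
split=> [cI|[iA kA]].
  have /eqP E : tri i k j :&: A == [set inord i; inord k].
    by rewrite eqEcard sI c2 cI.
  by have := set21 (inord i : V) (inord k); have := set22 (inord i : V) (inord k);
    rewrite -E !inE => /andP[_ ->] /andP[_ ->].
rewrite -c2; apply: eq_card => v; apply/idP/idP => [/(subsetP sI)//|].
by rewrite !inE => /orP[] /eqP ->; rewrite ?iA ?kA eqxx ?orbT.
Qed.

Lemma root_right_adjacent A : A \in faces r k ->
  #|tri i k j :&: A| = 2 <-> inord k \in A /\ inord j \in A.
Proof.
have [fl fr Ej] := fits_node ft; move: (ft); rewrite /fits Ej -/k -/j => jn.
move=> /(faces_in fr) /tri_in_sub => /(_ fr) /subsetP sA.
have ik : i < k by rewrite /k; lia.
have kj : k < j by rewrite /j; lia.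
have sI : tri i k j :&: A \subset [set inord k; inord j].
  apply/subsetP => v; rewrite inE in_tri; try lia.
  move=> /andP[vt /sA]; rewrite inE -/k -/j !inE -!val_eqE /= !inordK; lia.
have c2 : #|[set (inord k : V); inord j]| = 2.
  by rewrite cards2 -val_eqE /= !inordK; lia.
split=> [cI|[kA jA]].
  have /eqP E : tri i k j :&: A == [set inord k; inord j].
    by rewrite eqEcard sI c2 cI.
  by have := set21 (inord k : V) (inord j); have := set22 (inord k : V) (inord j);
    rewrite -E !inE => /andP[_ ->] /andP[_ ->].
rewrite -c2; apply: eq_card => v; apply/idP/idP => [/(subsetP sI)//|].
by rewrite !inE => /orP[] /eqP ->; rewrite ?kA ?jA eqxx ?orbT.
Qed.

Lemma left_right_nonadjacent A A' : A \in faces l i -> A' \in faces r k ->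
  #|A :&: A'| <> 2.
Proof.
have [fl fr Ej] := fits_node ft.
move=> /(faces_in fl) /tri_in_sub => /(_ fl) /subsetP sA.
move=> /(faces_in fr) /tri_in_sub => /(_ fr) /subsetP sA'.
have : #|A :&: A'| <= #|[set inord k : V]|.
  apply/subset_leq_card/subsetP => v; rewrite !inE => /andP[/sA + /sA'].
  by move: (fl); rewrite /fits !inE -/k => ? ? ?; rewrite -val_eqE /= inordK; lia.
by rewrite cards1; lia.
Qed.

Lemma proper_left c B : proper_colouring c i j (faces (Node l r) i) B ->
  proper_colouring (~~ c) i k (faces l i) (B :&: faces l i).
Proof.
case=> sB rB aB; split=> [|A Al iA kA|A A' Al Al' cI].
- exact: subsetIr.
- have := aB _ _ (root_in l r i) (left_in r Al) ((root_left_adjacent Al).2 (conj iA kA)).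
  have [fl fr Ej] := fits_node ft; move: (ft); rewrite /fits Ej -/k -/j => jn.
  have [iR _ jR] : [/\ inord i \in tri i k j, inord k \in tri i k j & inord j \in tri i k j].
    by apply: tri_vertices => //; rewrite /j /k; lia.
  by rewrite inE Al andbT rB // ?root_in //; case: c {rB}; case: (A \in B).
- by rewrite !inE Al Al' !andbT; apply: aB => //; apply: left_in.
Qed.

Lemma proper_right c B : proper_colouring c i j (faces (Node l r) i) B ->
  proper_colouring (~~ c) k j (faces r k) (B :&: faces r k).
Proof.
case=> sB rB aB; split=> [|A Ar kA jA|A A' Ar Ar' cI].
- exact: subsetIr.
- have := aB _ _ (root_in l r i) (right_in Ar) ((root_right_adjacent Ar).2 (conj kA jA)).
  have [fl fr Ej] := fits_node ft; move: (ft); rewrite /fits Ej -/k -/j => jn.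
  have [iR _ jR] : [/\ inord i \in tri i k j, inord k \in tri i k j & inord j \in tri i k j].
    by apply: tri_vertices => //; rewrite /j /k; lia.
  by rewrite inE Ar andbT rB // ?root_in //; case: c {rB}; case: (A \in B).
- by rewrite !inE Ar Ar' !andbT; apply: aB => //; apply: right_in.
Qed.

Lemma proper_node c Bl Br :
  proper_colouring (~~ c) i k (faces l i) Bl ->
  proper_colouring (~~ c) k j (faces r k) Br ->
  proper_colouring c i j (faces (Node l r) i)
    ((if c then [set tri i k j] else set0) :|: (Bl :|: Br)).
Proof.
have [fl fr Ej] := fits_node ft; move: (ft); rewrite /fits Ej -/k -/j => jn.
move=> [sl rl al] [sr rr ar]; set B := _ :|: _.
have BR : (tri i k j \in B) = c.
  rewrite !inE; have /negPf -> : tri i k j \notin Bl.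
    by apply: contra (subsetP sl _) (root_notin_left ft).
  have /negPf -> : tri i k j \notin Br.
    by apply: contra (subsetP sr _) (root_notin_right ft).
  by rewrite !orbF; case: (c); rewrite inE ?eqxx.
have BL A : A \in faces l i -> (A \in B) = (A \in Bl).
  move=> Al; rewrite !inE; have /negPf -> : A \notin Br.
    by apply: contra (subsetP sr _) (left_right_disjoint ft Al).
  rewrite orbF; case: (c); rewrite inE //; case: eqP => // EA.
  by rewrite EA (negPf (root_notin_left ft)) in Al.
have BRr A : A \in faces r k -> (A \in B) = (A \in Br).
  move=> Ar; rewrite !inE; have /negPf -> : A \notin Bl.
    by apply/negP => /(subsetP sl) Al; rewrite (negPf (left_right_disjoint ft Al)) in Ar.
  case: (c); rewrite inE //; case: eqP => // EA.
  by rewrite EA (negPf (root_notin_right ft)) in Ar.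
split.
- rewrite !subUset; apply/and3P; split.
  + by case: (c); rewrite ?sub0set // sub1set root_in.
  + by apply/subsetP => A /(subsetP sl); apply: left_in.
  + by apply/subsetP => A /(subsetP sr); apply: right_in.
- by move=> A AT iA jA; rewrite (root_unique ft AT iA jA).
(* [sym] and [sym'] treat pairs whose second face lies in the left or right subtree; the other pairs
   follow by exchanging the two faces. *)
- have sym A A' : A \in faces (Node l r) i -> A' \in faces l i -> #|A :&: A'| = 2 ->
      (A \in B) != (A' \in B).
    move=> /(node_faceP ft)[-> Al' cI|Al _ Al' cI|Ar _ Al' cI].
    + have [iA kA] := (root_left_adjacent Al').1 cI.
      by rewrite BR BL // rl //; case: (c).
    + by rewrite !BL //; apply: al.
    + by rewrite setIC in cI; case: (left_right_nonadjacent Al' Ar).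
  have sym' A A' : A \in faces (Node l r) i -> A' \in faces r k -> #|A :&: A'| = 2 ->
      (A \in B) != (A' \in B).
    move=> /(node_faceP ft)[-> Al' cI|Al _ Al' cI|Ar _ Al' cI].
    + have [iA kA] := (root_right_adjacent Al').1 cI.
      by rewrite BR BRr // rr //; case: (c).
    + by case: (left_right_nonadjacent Al Al').
    + by rewrite !BRr //; apply: ar.
  move=> A A' AT A'T cI.
  case: (node_faceP ft A'T) => [EA'|Al _|Ar _]; [|exact: sym|exact: sym'].
  rewrite setIC in cI; rewrite eq_sym.
  case: (node_faceP ft AT) => [EA|Al _|Ar _]; [|exact: sym|exact: sym'].
  by move: cI; rewrite EA EA' setIid card_tri //; rewrite /j /k; lia.
Qed.

End ColourNode.

Lemma proper_exists t c i : fits t i ->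
  exists B, proper_colouring c i (i + (nodes t).+1) (faces t i) B.
Proof.
elim: t c i => [|l IHl r IHr] c i ft.
  by exists set0; split=> [|A|A A']; rewrite ?inE ?sub0set.
have [fl fr Ej] := fits_node ft.
have [Bl Pl] := IHl (~~ c) _ fl; have [Br Pr] := IHr (~~ c) _ fr.
by rewrite Ej; eexists; apply: proper_node Pl Pr.
Qed.

(** Stated for every proper colouring, since [black] is whichever one [pick] returns. *)
Lemma card_proper t c i B : fits t i ->
  proper_colouring c i (i + (nodes t).+1) (faces t i) B -> #|B| = coloured c t.
Proof.
elim: t c i B => [|l IHl r IHr] c i B ft.
  by case; rewrite subset0 => /eqP -> _ _; rewrite cards0.
have [fl fr Ej] := fits_node ft; rewrite Ej => PB.
have Pl := proper_left ft PB; have Pr := proper_right ft PB.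
case: (PB) => sB rB _; rewrite (card_node ft sB) (IHl _ _ _ fl Pl) (IHr _ _ _ fr Pr).
rewrite rB ?root_in // in_tri ?inordK ?eqxx ?orbT //; move: (ft); rewrite /fits Ej; lia.
Qed.

Lemma is_checkerboardP (T B : {set {set V}}) :
  is_checkerboard T B <-> proper_colouring true 0 n.+1 T B.
Proof.
have E0 : ord0 = inord 0 :> V by apply/val_inj; rewrite /= inordK.
have En : ord_max = inord n.+1 :> V by apply/val_inj; rewrite /= inordK.
rewrite /is_checkerboard; split.
  move=> /and3P[sB /forall_inP rB /forall_inP aB]; split=> // [A AT iA jA|A A' AT A'T cI].
    by apply: (implyP (rB A AT)); rewrite /marked_edge E0 En subUset !sub1set iA.
  by have /forall_inP/(_ A' A'T)/implyP := aB A AT; apply; apply/eqP.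
move=> [sB rB aB]; apply/and3P; split=> //.
  apply/forall_inP => A AT; apply/implyP; rewrite /marked_edge E0 En subUset !sub1set.
  by move=> /andP[? ?]; rewrite rB.
apply/forall_inP => A AT; apply/forall_inP => A' A'T; apply/implyP => /eqP.
exact: aB.
Qed.

Lemma n_b_faces t : nodes t = n -> n_b (faces t 0) = coloured true t.
Proof.
move=> tn; have ft : fits t 0 by rewrite /fits tn.
rewrite /n_b /black; case: pickP => [B /is_checkerboardP PB|no].
  by apply: (@card_proper _ _ 0) => //; rewrite add0n tn.
(* The default [set0] of [black] is excluded, because a proper colouring exists. *)
have [B] := proper_exists true ft; rewrite add0n tn => /is_checkerboardP.
by rewrite no.
Qed.

Lemma n_w_faces t : nodes t = n -> n_w (faces t 0) = n - coloured true t.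
Proof.
move=> tn; have ft : fits t 0 by rewrite /fits tn.
rewrite -n_b_faces // /n_w /n_b cardsD (setIidPr _) ?card_faces ?tn //.
rewrite /black; case: pickP => [B /and3P[]//|_]; exact: sub0set.
Qed.

End Faces.

(** * Triangulations of a strictly convex polygon *)

Section Orientation.
Variable R : realType.
Implicit Types a b c x v : 'rV[R]_2.

Lemma row2P a b : a 0 0 = b 0 0 -> a 0 1 = b 0 1 -> a = b.
Proof.
move=> e0 e1; apply/rowP => -[[|[|//]] lt].
  by rewrite (_ : Ordinal lt = 0) //; apply/val_inj.
by rewrite (_ : Ordinal lt = 1) //; apply/val_inj.
Qed.

Lemma orientation_swap a b c : orientation b a c = - orientation a b c.
Proof. by rewrite /orientation; ring. Qed.

Lemma orientation_swap23 a b c : orientation a c b = - orientation a b c.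
Proof. by rewrite /orientation; ring. Qed.

Lemma orientation_cycle a b c : orientation b c a = orientation a b c.
Proof. by rewrite /orientation; ring. Qed.

Lemma orientation_aba a b : orientation a b a = 0.
Proof. by rewrite /orientation; ring. Qed.

Lemma orientation_abb a b : orientation a b b = 0.
Proof. by rewrite /orientation; ring. Qed.

Definition cross a v : R := a 0 0 * v 0 1 - a 0 1 * v 0 0.

Lemma orientationD a b x (e : R) v :
  orientation a b (x + e *: v) = orientation a b x + e * cross (b - a) v.
Proof. by rewrite /orientation /cross !mxE; ring. Qed.

(** Orientation is affine in its last argument. *)
Lemma orientation_sum (I : finType) (S : {set I}) (p : I -> 'rV[R]_2) (w : I -> R) a b :
  \sum_(i in S) w i = 1 ->
  orientation a b (\sum_(i in S) w i *: p i) =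
  \sum_(i in S) w i * orientation a b (p i).
Proof.
move=> w1; have [C E] : exists C, forall x,
    orientation a b x = (b 0 0 - a 0 0) * x 0 1 - (b 0 1 - a 0 1) * x 0 0 - C.
  exists ((b 0 0 - a 0 0) * a 0 1 - (b 0 1 - a 0 1) * a 0 0) => x.
  by rewrite /orientation; ring.
under [RHS]eq_bigr do rewrite E !mulrBr.
rewrite E !sumrB -mulr_suml w1 mul1r !summxE !mulr_sumr.
by congr (_ - _ - _); apply: eq_bigr => i _; rewrite !mxE; ring.
Qed.

Lemma barycentric a b c x : orientation a b c != 0 ->
  x = (orientation b c x / orientation a b c) *: a +
      (orientation c a x / orientation a b c) *: b +
      (orientation a b x / orientation a b c) *: c.
Proof.
move=> D0; have H u r : orientation a b c * (u / orientation a b c * r) = u * r.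
  by rewrite mulrA mulrCA divff // mulr1.
by apply: row2P; rewrite !mxE; apply: (mulfI D0); rewrite !mulrDr !H /orientation; ring.
Qed.

Lemma barycentric_sum a b c x : orientation a b c != 0 ->
  orientation b c x / orientation a b c + orientation c a x / orientation a b c +
  orientation a b x / orientation a b c = 1.
Proof.
move=> D0; rewrite -!mulrDl; apply: (mulIf D0); rewrite divfK // mul1r.
by rewrite /orientation; ring.
Qed.

Lemma small_perturbation (s K : R) : 0 < s ->
  exists2 e0, 0 < e0 & forall e, 0 < e -> e <= e0 -> 0 < s + e * K.
Proof.
move=> s0; have K1 : 0 < `|K| + 1 by rewrite ltr_pwDr.
exists (s / (`|K| + 1)); first by rewrite divr_gt0.
move=> e e0; rewrite ler_pdivlMr // mulrDr mulr1 => es.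
have : e * - K <= e * `|K| by rewrite ler_pM2l // -normrN ler_norm.
by rewrite mulrN; lra.
Qed.

(* With [x] the crossing point of the diagonals [ac] and [bd], the point
   [x + e (D (d - b) - F (c - a))], where [D] and [F] are the orientations of
   [a, c, e0] and [b, d, f0], lies for small [e > 0] on the side of [ac]
   containing [e0] and on the side of [bd] containing [f0]. *)
Lemma crossing_triangles a b c d e0 f0 :
  0 < orientation a b c -> 0 < orientation b c d ->
  0 < orientation a b d -> 0 < orientation a c d ->
  orientation a c e0 != 0 -> orientation b d f0 != 0 ->
  exists x s1 s2 s3 r1 r2 r3,
    [/\ [/\ 0 < s1, 0 < s2 & 0 < s3], [/\ 0 < r1, 0 < r2 & 0 < r3],
        s1 + s2 + s3 = 1 /\ r1 + r2 + r3 = 1,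
        x = s1 *: a + s2 *: c + s3 *: e0 & x = r1 *: b + r2 *: d + r3 *: f0].
Proof.
move=> abc bcd abd acd De Df.
set D := orientation a c e0 in De *; set F := orientation b d f0 in Df *.
(* [Q] is twice the area of the quadrilateral [abcd], cut along [bd] here and along [ac] in [Q']. *)
pose Q := orientation b c d + orientation a b d.
have Q0 : 0 < Q by rewrite addr_gt0.
have Qn : Q != 0 by rewrite gt_eqF.
have Q' : Q = orientation a c d + orientation a b c by rewrite /Q /orientation; ring.
pose x := (orientation b c d / Q) *: a + (orientation a b d / Q) *: c.
have Ex : x = (orientation a c d / Q) *: b + (orientation a b c / Q) *: d.
  have H u r : Q * (u / Q * r) = u * r by rewrite mulrA mulrCA divff // mulr1.
  by apply: row2P; rewrite !mxE; apply: (mulfI Qn); rewrite !mulrDr !H /orientation; ring.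
pose v := D *: (d - b) - F *: (c - a).
have vac : cross (c - a) v = D * Q.
  by rewrite /cross /v /Q /orientation !mxE; ring.
have vbd : cross (d - b) v = F * Q.
  by rewrite /cross /v /Q /orientation !mxE; ring.
(* In these computations the correction term is a multiple of the sum of the weights of [x] minus
   one, hence zero. *)
have xce : orientation c e0 x = D * (orientation b c d / Q).
  have -> : orientation c e0 x = D * (orientation b c d / Q) +
    ((orientation b c d + orientation a b d) / Q - 1) * (c 0 1 * e0 0 0 - c 0 0 * e0 0 1).
    by rewrite /x /D /orientation !mxE; ring.
  by rewrite divff // subrr mul0r addr0.
have xea : orientation e0 a x = D * (orientation a b d / Q).
  have -> : orientation e0 a x = D * (orientation a b d / Q) +
    ((orientation b c d + orientation a b d) / Q - 1) * (e0 0 1 * a 0 0 - e0 0 0 * a 0 1).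
    by rewrite /x /D /orientation !mxE; ring.
  by rewrite divff // subrr mul0r addr0.
have xac : orientation a c x = 0.
  have -> : orientation a c x =
    ((orientation b c d + orientation a b d) / Q - 1) * (a 0 1 * c 0 0 - a 0 0 * c 0 1).
    by rewrite /x /orientation !mxE; ring.
  by rewrite divff // subrr mul0r.
have xdf : orientation d f0 x = F * (orientation a c d / Q).
  have -> : orientation d f0 x = F * (orientation a c d / Q) +
    ((orientation a c d + orientation a b c) / Q - 1) * (d 0 1 * f0 0 0 - d 0 0 * f0 0 1).
    by rewrite Ex /F /orientation !mxE; ring.
  by rewrite -Q' divff // subrr mul0r addr0.
have xfb : orientation f0 b x = F * (orientation a b c / Q).
  have -> : orientation f0 b x = F * (orientation a b c / Q) +
    ((orientation a c d + orientation a b c) / Q - 1) * (f0 0 1 * b 0 0 - f0 0 0 * b 0 1).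
    by rewrite Ex /F /orientation !mxE; ring.
  by rewrite -Q' divff // subrr mul0r addr0.
have xbd : orientation b d x = 0.
  have -> : orientation b d x =
    ((orientation a c d + orientation a b c) / Q - 1) * (b 0 1 * d 0 0 - b 0 0 * d 0 1).
    by rewrite Ex /orientation !mxE; ring.
  by rewrite -Q' divff // subrr mul0r.
(* At [x] the coordinates on [a], [c], [b] and [d] are positive and stay so after a small move,
   while those on [e0] and [f0] vanish and become [e * Q]. *)
have [e1 e1p H1] := small_perturbation (cross (e0 - c) v / D) (divr_gt0 bcd Q0).
have [e2 e2p H2] := small_perturbation (cross (a - e0) v / D) (divr_gt0 abd Q0).
have [e3 e3p H3] := small_perturbation (cross (f0 - d) v / F) (divr_gt0 acd Q0).
have [e4 e4p H4] := small_perturbation (cross (b - f0) v / F) (divr_gt0 abc Q0).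
pose e := Num.min (Num.min e1 e2) (Num.min e3 e4).
have ep : 0 < e by rewrite !lt_min e1p e2p e3p e4p.
have [le1 le2 le3 le4] : [/\ e <= e1, e <= e2, e <= e3 & e <= e4].
  by rewrite /e !ge_min !lexx ?orbT; split.
pose y := x + e *: v.
have Oy u u' : orientation u u' y = orientation u u' x + e * cross (u' - u) v.
  exact: orientationD.
exists y, (orientation c e0 y / D), (orientation e0 a y / D), (orientation a c y / D),
  (orientation d f0 y / F), (orientation f0 b y / F), (orientation b d y / F).
split; [| |by split; apply: barycentric_sum|exact: barycentric|exact: barycentric].
- have H u K : (D * u + e * K) / D = u + e * (K / D).
    by rewrite mulrDl mulrAC divff // mul1r mulrA.
  have Hac : (0 + e * (D * Q)) / D = e * Q by rewrite add0r mulrCA mulrAC divff // mul1r.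
  rewrite !Oy xce xea xac vac !H Hac.
  by split; [exact: H1|exact: H2|exact: mulr_gt0].
- have H u K : (F * u + e * K) / F = u + e * (K / F).
    by rewrite mulrDl mulrAC divff // mul1r mulrA.
  have Hbd : (0 + e * (F * Q)) / F = e * Q by rewrite add0r mulrCA mulrAC divff // mul1r.
  rewrite !Oy xdf xfb xbd vbd !H Hbd.
  by split; [exact: H3|exact: H4|exact: mulr_gt0].
Qed.

End Orientation.

Lemma sum_set3 (V : nmodType) (I : finType) (u v w : I) (F : I -> V) :
  u != v -> u != w -> v != w ->
  \sum_(i in [set u; v; w]) F i = F u + F v + F w.
Proof.
move=> uv uw vw; rewrite setUC big_setU1 ?big_setU1 ?big_set1 ?inE //=.
  by rewrite addrC.
by rewrite negb_or ![w == _]eq_sym uw.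
Qed.

(** * Triangulations of the polygon are the face families of trees *)

Section Polygon.
Variables (R : realType) (n : nat) (p : 'I_n.+2 -> 'rV[R]_2).
Hypothesis hp : strictly_convex_polygon p.
Local Notation V := 'I_n.+2.
Implicit Types (S A B : {set V}) (q : 'rV[R]_2).

Definition weights3 (u v : V) (a b c : R) (i : V) : R :=
  if i == u then a else if i == v then b else c.

Lemma weights3E (u v w : V) a b c : u != v -> u != w -> v != w ->
  [/\ weights3 u v a b c u = a, weights3 u v a b c v = b & weights3 u v a b c w = c].
Proof.
move=> uv uw vw; rewrite /weights3 !eqxx ![_ == u]eq_sym (negPf uv) (negPf uw).
by rewrite eq_sym (negPf vw).
Qed.

Lemma in_open_hull3 (u v w : V) a b c : u != v -> u != w -> v != w ->
  0 < a -> 0 < b -> 0 < c -> a + b + c = 1 ->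
  in_open_hull p [set u; v; w] (a *: p u + b *: p v + c *: p w).
Proof.
move=> uv uw vw a0 b0 c0 s1; have [Eu Ev Ew] := weights3E a b c uv uw vw.
exists (weights3 u v a b c); rewrite !sum_set3 // Eu Ev Ew; split=> // i.
by rewrite !inE -orbA => /or3P[] /eqP ->; rewrite ?Eu ?Ev ?Ew.
Qed.

Lemma in_hull3 (u v w : V) a b c : u != v -> u != w -> v != w ->
  0 <= a -> 0 <= b -> 0 <= c -> a + b + c = 1 ->
  in_hull p [set u; v; w] (a *: p u + b *: p v + c *: p w).
Proof.
move=> uv uw vw a0 b0 c0 s1; have [Eu Ev Ew] := weights3E a b c uv uw vw.
exists (weights3 u v a b c); rewrite !sum_set3 // Eu Ev Ew; split=> // i.
by rewrite !inE -orbA => /or3P[] /eqP ->; rewrite ?Eu ?Ev ?Ew.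
Qed.

Lemma in_hull_sub S S' q : S \subset S' -> in_hull p S q -> in_hull p S' q.
Proof.
move=> sS [a [a0 a1 Eq]]; exists (fun i => if i \in S then a i else 0).
split=> [i _|| ].
- by case: ifP => // /a0.
- rewrite -big_mkcondr -{}a1; apply: eq_bigl => i /=.
  by case: (boolP (i \in S)) => [/(subsetP sS) ->|]; rewrite ?andbF.
- rewrite Eq [RHS](eq_bigr (fun i => if i \in S then a i *: p i else 0)); last first.
    by move=> i _; case: (i \in S); rewrite ?scale0r.
  rewrite -big_mkcondr; apply: eq_bigl => i /=.
  by case: (boolP (i \in S)) => [/(subsetP sS) ->|]; rewrite ?andbF.
Qed.

Lemma orientation_hull_ge0 S q a b : in_hull p S q ->
  (forall i, i \in S -> 0 <= orientation a b (p i)) -> 0 <= orientation a b q.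
Proof.
move=> [w [w0 w1 ->]] H; rewrite orientation_sum //.
by apply: sumr_ge0 => i iS; rewrite mulr_ge0 ?w0 ?H.
Qed.

Lemma in_open_hullW S q : in_open_hull p S q -> in_hull p S q.
Proof. by move=> [w [w0 w1 E]]; exists w; split=> // i /w0/ltW. Qed.

Lemma orientation_open_gt0 S q a b : in_open_hull p S q ->
  (forall i, i \in S -> 0 <= orientation a b (p i)) ->
  (exists2 i, i \in S & 0 < orientation a b (p i)) -> 0 < orientation a b q.
Proof.
move=> [w [w0 w1 ->]] H [i iS Hi]; rewrite orientation_sum // (bigD1 i) //=.
rewrite ltr_pwDl ?mulr_gt0 ?w0 //.
by apply: sumr_ge0 => k /andP[kS _]; rewrite mulr_ge0 ?H // ltW ?w0.
Qed.

Local Notation P k := (p (inord k)).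

Lemma orientation_gt0 x y z : (x < y < z)%N -> (z < n.+2)%N ->
  0 < orientation (P x) (P y) (P z).
Proof. by move=> *; apply: (proj2 hp); rewrite !inordK; lia. Qed.

Lemma orientation_neq0 (u v w : V) : u != v -> u != w -> v != w ->
  orientation (p u) (p v) (p w) != 0.
Proof.
have pos (a b c : V) : (a < b)%N -> (b < c)%N -> orientation (p a) (p b) (p c) != 0.
  by move=> ab bc; rewrite gt_eqF // (proj2 hp) // ab.
rewrite -!val_eqE /=.
case: (ltngtP u v) => // uv _; case: (ltngtP u w) => // uw _;
  case: (ltngtP v w) => // vw _; try lia.
- exact: pos.
- by rewrite orientation_swap23 oppr_eq0; apply: pos.
- by rewrite orientation_cycle; apply: pos.
- by rewrite orientation_swap oppr_eq0; apply: pos.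
- by rewrite -orientation_cycle; apply: pos.
- by rewrite orientation_swap oppr_eq0 -orientation_cycle -orientation_cycle; apply: pos.
Qed.

Lemma third_vertex A (u v : V) : #|A| = 3%N -> u \in A -> v \in A -> u != v ->
  exists w, [/\ u != w, v != w & A = [set u; v; w]].
Proof.
move=> A3 uA vA uv; have : (0 < #|A :\: [set u; v]|)%N.
  rewrite cardsD (setIidPr _) ?A3 ?cards2 ?uv //.
  by apply/subsetP => i; rewrite !inE => /orP[] /eqP ->.
case/card_gt0P => w; rewrite !inE negb_or -andbA => /and3P[wu wv wA].
exists w; rewrite eq_sym wu eq_sym wv; split=> //; apply/esym/eqP.
rewrite eqEcard A3; apply/andP; split.
  by apply/subsetP => i; rewrite !inE -orbA => /or3P[] /eqP ->.
by rewrite setUC cardsU1 cards2 !inE negb_or wu wv uv.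
Qed.

(** Crossing sides [ac] and [bd], completed by third vertices, would give a common interior point by
    [crossing_triangles]. *)
Lemma open_disjoint_noncrossing A B : #|A| = 3%N -> #|B| = 3%N ->
  (A != B -> ~ exists q, in_open_hull p A q /\ in_open_hull p B q) ->
  noncrossing A B.
Proof.
move=> A3 B3 AB a b c d abc cd.
have [abc' bcd abd acd] : [/\ a < b < c, b < c < d, a < b < d & a < c < d]%N.
  by split; lia.
have [cn dn] : (c < n.+2 /\ d < n.+2)%N by lia.
have [ac_ bd_] : (a < c /\ b < d)%N by lia.
move=> aA cA bB dB.
have neq (x y : nat) : (x < y)%N -> (y < n.+2)%N -> inord x != inord y :> V.
  by move=> *; rewrite -val_eqE /= !inordK; lia.
have nAB : A != B.
  apply/eqP => EAB; rewrite -{}EAB in bB dB.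
  have [x [y [z [_ xyz zn EA]]]] := card3_tri A3.
  by move: aA bB cA dB; rewrite EA !in_tri ?inordK; lia.
have ac : inord a != inord c :> V by apply: neq.
have bd : inord b != inord d :> V by apply: neq.
have [e [ae ce EA]] := third_vertex A3 aA cA ac.
have [f [bf df EB]] := third_vertex B3 bB dB bd.
have [|||||| q [s1 [s2 [s3 [r1 [r2 [r3 [[? ? ?] [? ? ?] [? ?] Es Er]]]]]]]] :=
    @crossing_triangles R (P a) (P b) (P c) (P d) (p e) (p f).
- exact: orientation_gt0 abc' cn.
- exact: orientation_gt0 bcd dn.
- exact: orientation_gt0 abd dn.
- exact: orientation_gt0 acd dn.
- exact: orientation_neq0.
- exact: orientation_neq0.
apply: AB => //; exists q; split.
- by rewrite EA Es; apply: in_open_hull3.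
- by rewrite EB Er; apply: in_open_hull3.
Qed.

(** The [n] triangles attain the bound of [max_noncrossingP], whose equality case supplies the
    tree. *)
Lemma triangulation_faces T : is_triangulation p T ->
  exists2 t, nodes t = n & T = faces n t 0.
Proof.
move=> [cT T3 Tdis _].
have [] := @max_noncrossingP n n 0 T _ _ _ => //.
- by move=> A /T3; apply: card3_tri.
- by move=> A B AT BT; apply: open_disjoint_noncrossing; auto.
- by move=> _; apply.
Qed.

Lemma in_hull_tri x y z q : (x < y < z)%N -> (z < n.+2)%N ->
  0 <= orientation (P x) (P y) q -> 0 <= orientation (P y) (P z) q ->
  0 <= orientation (P z) (P x) q -> in_hull p (tri n x y z) q.
Proof.
move=> xyz zn oxy oyz ozx; have D := orientation_gt0 xyz zn.
have D0 : orientation (P x) (P y) (P z) != 0 by rewrite gt_eqF.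
rewrite {1}(barycentric q D0); apply: in_hull3; rewrite -?val_eqE /= ?inordK;
  rewrite ?divr_ge0 ?(ltW D) //; try lia.
exact: barycentric_sum.
Qed.

(** A point beyond the side [ik] or [kj] of the root triangle is covered by the subtree there; if
    that subtree is a leaf, the side is an edge and the point is on its inner side. Otherwise the
    point is in the root triangle. *)
Lemma faces_cover t i q : fits n t i -> (0 < nodes t)%N ->
  (forall k, (i <= k <= i + nodes t)%N -> 0 <= orientation (P k) (P k.+1) q) ->
  0 <= orientation (P (i + (nodes t).+1)) (P i) q ->
  exists2 A, A \in faces n t i & in_hull p A q.
Proof.
elim: t i => [|l IHl r IHr] i ft // _; have [fl fr Ej] := fits_node ft.
rewrite Ej; set k := (i + (nodes l).+1)%N; set j := (k + (nodes r).+1)%N => edges base.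
have jn : (j < n.+2)%N by move: (ft); rewrite /fits Ej.
have cover_left : (exists2 A, A \in faces n l i & in_hull p A q) \/
    0 <= orientation (P i) (P k) q.
  have [l0|l0] := posnP (nodes l).
    by right; rewrite /k l0 addn1; apply: edges; rewrite leqnn leq_addr.
  have [o|o] := leP 0 (orientation (P k) (P i) q); last first.
    by right; rewrite orientation_swap oppr_ge0 ltW.
  by left; apply: IHl => // m ?; apply: edges; move=> /=; lia.
case: cover_left => [[A Al Aq]|oik]; first by exists A => //; apply: left_in.
have cover_right : (exists2 A, A \in faces n r k & in_hull p A q) \/
    0 <= orientation (P k) (P j) q.
  have [r0|r0] := posnP (nodes r).
    by right; rewrite /j r0 addn1; apply: edges; rewrite /k /=; lia.
  have [o|o] := leP 0 (orientation (P j) (P k) q); last first.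
    by right; rewrite orientation_swap oppr_ge0 ltW.
  by left; apply: IHr => // m; rewrite /k => ?; apply: edges; move=> /=; lia.
case: cover_right => [[A Ar Aq]|okj]; first by exists A => //; apply: right_in.
exists (tri n i k j); first exact: root_in.
by apply: in_hull_tri => //; rewrite /j /k; lia.
Qed.

Lemma open_left_of_chord i k A q : (k < n.+2)%N -> tri_in i k A ->
  in_open_hull p A q -> 0 < orientation (P k) (P i) q.
Proof.
move=> kn Aik; have [x [y [z [ix xyz zk EA]]]] := Aik.
have pos v : (i < v < k)%N -> 0 < orientation (P k) (P i) (P v).
  by move=> ivk; rewrite -orientation_cycle; apply: orientation_gt0.
move=> Aq; apply: orientation_open_gt0 Aq _ _.
  move=> v /(subsetP (tri_in_sub kn Aik)); rewrite inE => /andP[iv vk].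
  rewrite -[v]inord_val.
  move: iv; rewrite leq_eqVlt => /orP[/eqP <-|iv]; first by rewrite orientation_abb.
  move: vk; rewrite leq_eqVlt => /orP[/eqP ->|vk]; first by rewrite orientation_aba.
  by rewrite ltW // pos ?iv.
exists (inord y); last by apply: pos; lia.
by rewrite EA in_tri ?inordK ?eqxx ?orbT //; lia.
Qed.

(** A weak inequality suffices, as [open_left_of_chord] is strict on the other side. *)
Lemma open_right_of_chord i k j A q : (i < k)%N -> (j < n.+2)%N -> tri_in k j A ->
  in_open_hull p A q -> 0 <= orientation (P i) (P k) q.
Proof.
move=> ik jn Akj Aq; apply: orientation_hull_ge0 (in_open_hullW Aq) _ => v.
move=> /(subsetP (tri_in_sub jn Akj)); rewrite inE => /andP[kv vj].
rewrite -[v]inord_val.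
move: kv; rewrite leq_eqVlt => /orP[/eqP <-|kv]; first by rewrite orientation_abb.
by apply/ltW/orientation_gt0; rewrite ?ik ?ltn_ord.
Qed.

Lemma open_tri x y z q : (x < y < z)%N -> (z < n.+2)%N ->
  in_open_hull p (tri n x y z) q ->
  0 < orientation (P x) (P y) q /\ 0 < orientation (P y) (P z) q.
Proof.
move=> xyz zn Aq; have D := orientation_gt0 xyz zn.
have [xA yA zA] := tri_vertices xyz zn.
split; apply: (orientation_open_gt0 Aq).
- move=> v; rewrite !inE -orbA => /or3P[] /eqP ->.
  + by rewrite orientation_aba.
  + by rewrite orientation_abb.
  + exact: ltW.
- by exists (inord z).
- move=> v; rewrite !inE -orbA => /or3P[] /eqP ->.
  + by rewrite orientation_cycle ltW.
  + by rewrite orientation_aba.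
  + by rewrite orientation_abb.
- by exists (inord x); rewrite // orientation_cycle.
Qed.

(** The chord [ik] separates the left faces from the root triangle and from the right faces; the
    chord [kj] separates the right faces from the root triangle. *)
Lemma faces_open_disjoint t i A B q : fits n t i ->
  A \in faces n t i -> B \in faces n t i ->
  in_open_hull p A q -> in_open_hull p B q -> A = B.
Proof.
elim: t i A B => [|l IHl r IHr] i A B ft; first by rewrite inE.
have [fl fr Ej] := fits_node ft.
move: (fl) (ft); rewrite /fits Ej; set k := (i + _)%N; set j := (k + _)%N => kn jn.
have ikj : (i < k < j)%N by rewrite /j /k; lia.
have absurd a b : 0 < orientation a b q -> 0 <= orientation b a q -> False.
  by rewrite orientation_swap; lra.
move=> /(node_faceP ft)[->|Al Ti|Ar Tk] /(node_faceP ft)[->|Bl Ti'|Br Tk'] // Aq Bq.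
- have [oik _] := open_tri ikj jn Aq.
  by case: (absurd _ _ oik); apply/ltW/(open_left_of_chord kn Ti' Bq).
- have [_ okj] := open_tri ikj jn Aq.
  by case: (absurd _ _ okj); apply/ltW/(open_left_of_chord jn Tk' Bq).
- have [oik _] := open_tri ikj jn Bq.
  by case: (absurd _ _ oik); apply/ltW/(open_left_of_chord kn Ti Aq).
- exact: (IHl i).
- case: (absurd _ _ (open_left_of_chord kn Ti Aq)).
  by apply: (open_right_of_chord _ jn Tk' Bq); lia.
- have [_ okj] := open_tri ikj jn Bq.
  by case: (absurd _ _ okj); apply/ltW/(open_left_of_chord jn Tk Aq).
- case: (absurd _ _ (open_left_of_chord kn Ti' Bq)).
  by apply: (open_right_of_chord _ jn Tk Aq); lia.
- exact: (IHr k).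
Qed.

(** For [n = 0] the hull is a segment, which the empty family does not cover; [w] treats that case
    apart. *)
Lemma faces_triangulation t : (0 < n)%N -> nodes t = n ->
  is_triangulation p (faces n t 0).
Proof.
move=> n0 tn; have ft : fits n t 0 by rewrite /fits tn.
split=> [|A At|A B At Bt AB [q [Aq Bq]]|q].
- by rewrite card_faces.
- have [x [y [z [_ xyz zt ->]]]] := faces_in ft At.
  by rewrite card_tri //; move: zt; rewrite tn; lia.
- by move/eqP: AB; apply; apply: faces_open_disjoint At Bt Aq Bq.
split=> [Hq|[A _ Aq]]; last by apply: in_hull_sub Aq; apply: subsetT.
apply: faces_cover; rewrite ?tn //.
  (* All vertices, hence all points of the hull, lie on the inner side of each edge. *)
  move=> k kn; apply: orientation_hull_ge0 Hq _ => v _; rewrite -[v]inord_val.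
  have vn := ltn_ord v.
  case: (ltngtP v k) => [vk|kv|<-]; last by rewrite orientation_aba.
    by rewrite orientation_cycle; apply/ltW/orientation_gt0; lia.
  case: (ltngtP k.+1 v) => [kv'||<-]; [|lia|by rewrite orientation_abb].
  by apply/ltW/orientation_gt0; lia.
apply: orientation_hull_ge0 Hq _ => v _; rewrite -[v]inord_val add0n.
have vn := ltn_ord v.
case: (posnP v) => [->|v0]; first by rewrite orientation_abb.
case: (ltngtP v n.+1) => [vn'||->]; [|lia|by rewrite orientation_aba].
by rewrite -orientation_cycle; apply/ltW/orientation_gt0; lia.
Qed.

(** * Coefficients of [w] as counts of trees *)

Lemma is_triangulationE T : (0 < n)%N ->
  `[< is_triangulation p T >] = (T \in [seq faces n t 0 | t <- trees n]).
Proof.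
move=> n0; apply/asboolP/mapP => [/triangulation_faces[t tn ->]|[t]].
  by exists t; rewrite // mem_trees tn.
by rewrite mem_trees => /eqP tn ->; apply: faces_triangulation.
Qed.

(** Black and white triangles add up to [n], so the exponent is twice the black count minus [n]. For
    [n = 0] the leaf gives the term 1. *)
Lemma coef_w (j : int) : (w p)@_j =
  \sum_(t <- trees n) ((coloured true t).*2%:Z - n%:Z == j)%:R.
Proof.
have uniq_faces : uniq [seq faces n t 0 | t <- trees n].
  rewrite map_inj_in_uniq ?uniq_trees // => t t'; rewrite !mem_trees.
  by move=> /eqP tn /eqP tn'; apply: faces_inj; rewrite /fits ?tn ?tn'.
rewrite /w; case: (posnP n) => [n0|n0].
  by rewrite n0 trees0 big_seq1 mcoeffU.
rewrite (eq_bigl _ _ (fun T => is_triangulationE T n0)) -big_uniq // big_map.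
rewrite raddf_sum /=; apply: eq_big_seq => t; rewrite mem_trees => /eqP tn.
rewrite mcoeffU n_b_faces // n_w_faces //; congr (_ == _)%:R.
by have := coloured_negb true t; rewrite tn; lia.
Qed.

End Polygon.

Theorem theorem2p2 (R : realType) (n : nat) (p : 'I_n.+2 -> 'rV[R]_2)
    (hp : strictly_convex_polygon p) (j : int) :
  (n%:Z + 2 + 3 * j) * (w p)@_(- j) = (n%:Z + 2 - 3 * j) * (w p)@_j.
Proof.
have coef_count (b c : nat) (k : int) : (b + c = n)%N -> k = b%:Z - c%:Z ->
    (w p)@_k = count_trees n b.
  move=> bcn Ek; rewrite coef_w // /count_trees -sum1_count -[RHS]natz natr_sum.
  rewrite [RHS]big_mkcond; apply: eq_bigr => t _ /=.
  by case: eqP; case: eqP => //; lia.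
(* Exponents of the wrong parity or beyond [n] in absolute value do not occur. *)
have coef0 k : (forall b c : nat, (b + c = n)%N -> k <> b%:Z - c%:Z) -> (w p)@_k = 0.
  move=> nk; rewrite coef_w // big_seq big1 // => t; rewrite mem_trees => /eqP tn.
  have := coloured_negb true t; rewrite tn => E; case: eqP => // Ek.
  by case: (nk _ _ E); lia.
have [[b [c [bcn Ej]]]|nj] :=
    pselect (exists b c : nat, (b + c = n)%N /\ j = b%:Z - c%:Z).
  have cbn : (c + b = n)%N by rewrite addnC.
  rewrite (coef_count b c j) // (coef_count c b (- j)) ?Ej ?opprB //.
  have H := count_trees_reciprocity bcn.
  have -> : n%:Z = b%:Z + c%:Z by rewrite -bcn.
  (* With [n = b + c] and [j = b - c], the factors [n + 2 + 3 j] and [n + 2 - 3 j] are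
     [2 (2 b + 1 - c)] and [2 (2 c + 1 - b)]. *)
  transitivity (2 * ((2 * b%:Z + 1 - c%:Z) * count_trees n c)); first ring.
  by rewrite -H; ring.
rewrite !coef0 ?mulr0 // => b c bcn Ej; apply: nj.
  by exists b, c.
by exists c, b; rewrite addnC; split=> //; lia.
Qed.
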